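(* For all $m\ge 4$, \[ \gamma^{\mathrm{SID}}(K_m\times P_n)=\begin{cases}2m+3,& n=3,\\ 2m+6,& n=4.\end{cases} \]
   Context: For a vertex $v$, $N[v]$ is its closed neighborhood. A nonempty set $S\subseteq V(G)$ is a self-identifying code of $G$ if for every vertex $v\in V(G)$: (1) $N[v]\cap S\neq\emptyset$, and (2) $\bigcap_{c\in N[v]\cap S}N[c]=\{v\}$; $\gamma^{\mathrm{SID}}(G)$ is the minimum size of such a code. With $V(K_m)=\{v_0,\dots,v_{m-1}\}$ and $V(P_n)=\{0,\dots,n-1\}$ (consecutively numbered path), the direct product $K_m\times P_n$ has vertices $(v_i,j)$, with $(v_i,j)$ adjacent to $(v_{i'},j')$ iff $i\neq i'$ and $|j-j'|=1$. *)

(* Defs.v *)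
From mathcomp Require Import all_boot.

Set Implicit Arguments.
Unset Strict Implicit.
Unset Printing Implicit Defensive.

(* A simple graph on a finite vertex type is given by its adjacency relation. *)
Section SelfIdentifyingCodes.
Variables (T : finType) (e : rel T).

Definition closed_nbhd (v : T) : {set T} := [set u | (u == v) || e v u].

Definition self_identifying_code (S : {set T}) : Prop :=
  S != set0 /\
  forall v : T,
    closed_nbhd v :&: S != set0 /\
    \bigcap_(c in closed_nbhd v :&: S) closed_nbhd c = [set v].

(* gamma^SID is partial, since a graph may have no self-identifying code; this
   is its graph: a code of size k exists, and no code is smaller. *)
Definition is_gammaSID (k : nat) : Prop :=
  (exists S : {set T}, self_identifying_code S /\ #|S| = k) /\
  (forall S : {set T}, self_identifying_code S -> k <= #|S|).

End SelfIdentifyingCodes.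

Definition complete_graph (m : nat) : rel 'I_m := fun i i' => i != i'.

Definition path_graph (n : nat) : rel 'I_n :=
  fun j j' => (j.+1 == j' :> nat) || (j'.+1 == j :> nat).

Definition direct_product (T1 T2 : finType) (e1 : rel T1) (e2 : rel T2) :
    rel (T1 * T2) :=
  fun x y => e1 x.1 y.1 && e2 x.2 y.2.

Lemma complete_graph_sym m : symmetric (@complete_graph m).
Proof. by move=> i i'; rewrite /complete_graph eq_sym. Qed.

Lemma complete_graph_irr m : irreflexive (@complete_graph m).
Proof. by move=> i; rewrite /complete_graph eqxx. Qed.

Lemma path_graph_sym n : symmetric (@path_graph n).
Proof. by move=> j j'; rewrite /path_graph orbC. Qed.

Lemma path_graph_irr n : irreflexive (@path_graph n).
Proof. by move=> j; rewrite /path_graph orbb gtn_eqF. Qed.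

Lemma direct_product_sym (T1 T2 : finType) (e1 : rel T1) (e2 : rel T2) :
  symmetric e1 -> symmetric e2 -> symmetric (direct_product e1 e2).
Proof. by move=> s1 s2 x y; rewrite /direct_product s1 s2. Qed.

Lemma direct_product_irr (T1 T2 : finType) (e1 : rel T1) (e2 : rel T2) :
  irreflexive e1 -> irreflexive (direct_product e1 e2).
Proof. by move=> i1 x; rewrite /direct_product i1. Qed.

(* Main.v *)
Require Import Defs.
From mathcomp Require Import all_boot.

Set Implicit Arguments.
Unset Strict Implicit.
Unset Printing Implicit Defensive.

(** [S] is self-identifying iff every vertex [v] has, for each [u <> v], a
    codeword in [N[v]] outside [N[u]].  Let [p] be a leaf of [H] with neighbour
    [q].  In [K_m x H], separating [(i, p)] from [(i, r)], where [r <> p] is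
    another neighbour of [q], forces [(i, p)] into the code, and separating
    [(i, p)] from [(k, q)] forces a codeword [(l, q)] with [l] distinct from [i]
    and [k], so layer [q] has at least three codewords.  Conversely these two
    conditions separate all vertices of layers [p] and [q] from all others.  In
    [P_3] and [P_4] every vertex is a leaf or adjacent to a leaf. *)

(** * Self-identification as separation of ordered pairs of vertices *)

Section Codes.
Variables (T : finType) (e : rel T).
Hypothesis e_sym : symmetric e.

Definition separated (S : {set T}) (v u : T) : Prop :=
  exists c, [/\ c \in S, c \in closed_nbhd e v & c \notin closed_nbhd e u].

Lemma closed_nbhd_sym u v : (u \in closed_nbhd e v) = (v \in closed_nbhd e u).
Proof. by rewrite !inE eq_sym e_sym. Qed.

(** As [u] is missing from the intersection attached to [v], some codeword [c] in [N[v]] has [u]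
    outside [N[c]]; symmetry of [e] turns this into [c] outside [N[u]]. *)
Lemma sid_separated S v u :
  self_identifying_code e S -> u != v -> separated S v u.
Proof.
move=> [_ /(_ v) [_ capE]] uv.
have: u \notin [set v] by rewrite inE.
rewrite -capE => /bigcapP Nu.
case: (boolP [exists c, [&& c \in S, c \in closed_nbhd e v
                          & c \notin closed_nbhd e u]]).
  by case/existsP=> c /and3P[]; exists c.
rewrite negb_exists => /forallP Nc; case: Nu => c /setIP[cv cS].
by move: (Nc c); rewrite cS cv /= negbK closed_nbhd_sym.
Qed.

(** With a second vertex in the graph, each [v] has something to be separated from, and the
    separating codeword also dominates [v]. *)
Lemma separated_sid S :
  (exists x y : T, x != y) -> (forall v u, u != v -> separated S v u) ->
  self_identifying_code e S.
Proof.
move=> [x [y xy]] sepS.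
have nb v : closed_nbhd e v :&: S != set0.
  have [z zv] : exists z, z != v.
    by case: (eqVneq x v) xy => [-> | xv _]; [exists y; rewrite eq_sym | exists x].
  by have [c [cS cv _]] := sepS v z zv; apply/set0Pn; exists c; rewrite inE cv.
split=> [|v].
  by have /set0Pn[c /setIP[_ cS]] := nb x; apply/set0Pn; exists c.
split=> //; apply/setP=> u; rewrite in_set1; apply/bigcapP/eqP=> [capu | ->].
  apply/eqP; case: (eqVneq u v) => // uv.
  have [c [cS cv]] := sepS v u uv.
  by rewrite closed_nbhd_sym capu // inE cv.
by move=> c /setIP[cv _]; rewrite closed_nbhd_sym.
Qed.

End Codes.

(** * Cardinalities of sets and of layers *)

Lemma card_gt2_avoid (T : finType) (A : {set T}) (i k : T) :
  2 < #|A| -> exists2 l, l \in A & (l != i) && (l != k).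
Proof.
move=> A3; have /card_gt0P[l] : 0 < #|A :\: [set i; k]|.
  rewrite cardsD subn_gt0; apply: leq_ltn_trans A3.
  by apply: leq_trans (subset_leq_card (subsetIr _ _)) _; rewrite cards2; case: eqP.
by rewrite !inE negb_or => /andP[ikl lA]; exists l.
Qed.

Lemma avoid_card_gt2 (T : finType) (A : {set T}) :
  1 < #|T| ->
  (forall i k, i != k -> exists2 l, l \in A & (l != i) && (l != k)) -> 2 < #|A|.
Proof.
move=> /card_gt1P[i [k [_ _ ik]]] avA.
have [a aA /andP[ai _]] := avA i k ik.
(* Only [b != a] matters here; [i] just completes a pair of distinct points. *)
have [b bA /andP[ba _]] := avA a i ai.
have [c cA /andP[cb ca]] := avA b a ba.
by apply/card_gt2P; exists a, b, c; split; split; rewrite // eq_sym.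
Qed.

Definition layer (T1 T2 : finType) (S : {set T1 * T2}) (j : T2) : {set T1} :=
  [set i | (i, j) \in S].

Lemma card_layers (T1 T2 : finType) (S : {set T1 * T2}) :
  #|S| = \sum_(j : T2) #|layer S j|.
Proof.
rewrite -sum1_card; under [RHS]eq_bigr do rewrite -sum1_card.
rewrite (exchange_big_dep xpredT) //= pair_big_dep /=.
by apply: eq_bigl => -[i j]; rewrite inE.
Qed.

(** * Leaves and their neighbours in a product with a complete graph *)

Section LeafLayers.
Variables (m : nat) (H : finType) (h : rel H).
Hypotheses (h_sym : symmetric h) (h_irr : irreflexive h).

Let g := direct_product (@complete_graph m) h.

Let g_sym : symmetric g.
Proof. exact: direct_product_sym (@complete_graph_sym m) h_sym. Qed.

Definition leaf (p q : H) : Prop := forall x, h p x = (x == q).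

Lemma mem_closed_nbhd (c v : 'I_m * H) :
  (c \in closed_nbhd g v) = (c == v) || (v.1 != c.1) && h v.2 c.2.
Proof. by rewrite inE. Qed.

Lemma leaf_neq p q : leaf p q -> p != q.
Proof. by move=> lf; rewrite -lf h_irr. Qed.

(** Besides [(i, p)] itself, [N[(i, p)]] contains only vertices [(l, q)] with [l != i], and these
    are all adjacent to [(i, r)]. *)
Lemma leaf_layer_full S p q r : leaf p q -> h q r -> r != p ->
  self_identifying_code g S -> layer S p = [set: 'I_m].
Proof.
move=> lf qr rp sidS; apply/setP=> i; rewrite in_setT inE.
have ne : (i, r) != (i, p) by rewrite xpair_eqE negb_and rp orbT.
have [[l j] [cS]] := sid_separated g_sym sidS ne.
rewrite !mem_closed_nbhd /= lf => /orP[/eqP[<- <-] // | /andP[il /eqP->]].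
by rewrite il h_sym qr orbT.
Qed.

Lemma support_layer_card S p q : 1 < m -> leaf p q ->
  self_identifying_code g S -> 2 < #|layer S q|.
Proof.
move=> m1 lf sidS; apply: avoid_card_gt2 => [|i k ik]; first by rewrite card_ord.
have pq := leaf_neq lf.
have ne : (k, q) != (i, p) by rewrite xpair_eqE negb_and [q == p]eq_sym pq orbT.
have [[l j] [cS]] := sid_separated g_sym sidS ne.
rewrite !mem_closed_nbhd /= lf => /orP[/eqP[-> ->] | /andP[il /eqP jq]].
  (* The codeword cannot be [(i, p)], which is adjacent to [(k, q)] because [i != k]. *)
  by rewrite [k == i]eq_sym ik h_sym lf eqxx orbT.
rewrite {j}jq in cS *; rewrite negb_or xpair_eqE eqxx andbT => /andP[lk _].
by exists l; rewrite ?inE // eq_sym il.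
Qed.

Section Separation.
Variables (S : {set 'I_m * H}) (p q : H).
Hypotheses (lf : leaf p q) (Sp : layer S p = [set: 'I_m]).

Let full i : (i, p) \in S.
Proof. by move/setP: Sp => /(_ i); rewrite !inE. Qed.

(** If [u] lies in layer [q], a codeword of that layer avoiding both first coordinates separates,
    since no layer has inner edges. Otherwise [u] is not adjacent to [(i, p)], which is its own
    separator. *)
Lemma leaf_separated i u : 2 < #|layer S q| -> u != (i, p) ->
  separated g S (i, p) u.
Proof.
move=> Sq; case: u => k j ne; case: (eqVneq j q) => [-> | jq].
  have [l] := card_gt2_avoid i k Sq; rewrite inE => lS /andP[li lk].
  exists (l, q); split=> //; rewrite mem_closed_nbhd /=.
    by rewrite lf eqxx [i == l]eq_sym li orbT.
  by rewrite h_irr andbF orbF xpair_eqE negb_and lk.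
exists (i, p); split=> //; rewrite mem_closed_nbhd ?eqxx //=.
by rewrite h_sym lf (negPf jq) andbF orbF eq_sym.
Qed.

(** Layer [p] alone suffices: [(k, p)] misses its twin [(k, q)], and for [u] in another layer any
    [(l, p)] works with [l] a third index. *)
Lemma support_separated i u : 2 < m -> u != (i, q) -> separated g S (i, q) u.
Proof.
move=> m2; case: u => k j ne; case: (eqVneq j q) ne => [-> | jq] ne.
  have ki : k != i by move: ne; rewrite xpair_eqE eqxx andbT.
  exists (k, p); split=> //; rewrite mem_closed_nbhd /=.
    by rewrite h_sym lf eqxx [i == k]eq_sym ki orbT.
  by rewrite eqxx orbF xpair_eqE negb_and (leaf_neq lf) orbT.
have [|l _ /andP[li lk]] := @card_gt2_avoid _ [set: 'I_m] i k.
  by rewrite cardsT card_ord.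
exists (l, p); split=> //; rewrite mem_closed_nbhd /=.
  by rewrite h_sym lf eqxx [i == l]eq_sym li orbT.
by rewrite h_sym lf (negPf jq) andbF orbF xpair_eqE negb_and lk.
Qed.

End Separation.

Lemma leaf_cover_separated S : 2 < m ->
  (forall j, exists p q, [/\ leaf p q, layer S p = [set: 'I_m],
                             2 < #|layer S q| & (j == p) || (j == q)]) ->
  forall v u, u != v -> separated g S v u.
Proof.
move=> m2 cov [i j] u ne; have [p [q [lf Sp Sq /orP[]/eqP jE]]] := cov j;
  rewrite {j}jE in ne *.
- exact: leaf_separated lf Sp _ _ Sq ne.
- exact: support_separated lf Sp _ _ m2 ne.
Qed.

End LeafLayers.

(** * Codes on products with paths *)

(** For [n = 3] and [n = 4] every inner layer is next to an end layer, so this code meets each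
    layerwise lower bound with equality. *)
Definition path_code (m n : nat) : {set 'I_m * 'I_n} :=
  [set x : 'I_m * 'I_n | [|| x.2 == 0 :> nat, x.2 == n.-1 :> nat | x.1 < 3]].

Lemma path_code_end m n (j : 'I_n) :
  (j == 0 :> nat) || (j == n.-1 :> nat) -> layer (path_code m n) j = [set: 'I_m].
Proof. by move=> ej; apply/setP=> i; rewrite !inE orbA /= ej. Qed.

Lemma card_path_code_inner m n (j : 'I_n) : 2 < m ->
  ~~ ((j == 0 :> nat) || (j == n.-1 :> nat)) -> #|layer (path_code m n) j| = 3.
Proof.
move=> m2 nej.
have -> : layer (path_code m n) j = widen_ord m2 @: [set: 'I_3].
  apply/setP=> i; rewrite !inE orbA /= (negPf nej) /=.
  apply/idP/imsetP=> [i3 | [k _ ->]]; last exact: (ltn_ord k).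
  by exists (Ordinal i3); [rewrite inE | apply: val_inj].
rewrite card_imset ?cardsT ?card_ord //.
by move=> a b /(congr1 val) /= /val_inj.
Qed.

Section PathLeaves.
Variable n : nat.

Lemma path_leaf_first (p q : 'I_n) :
  p = 0 :> nat -> q = 1 :> nat -> leaf (@path_graph n) p q.
Proof. by move=> p0 q1 x; rewrite /path_graph -val_eqE /= p0 q1 orbF eq_sym. Qed.

Lemma path_leaf_last (p q : 'I_n) :
  p.+1 = n -> q.+1 = p -> leaf (@path_graph n) p q.
Proof.
move=> pn qp x; rewrite /path_graph -val_eqE /= pn -qp eqSS.
(* A successor of [p] would have value [n], out of range for [x]. *)
by rewrite eq_sym (ltn_eqF (ltn_ord x)).
Qed.

End PathLeaves.

(** * The values for paths on three and four vertices *)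

Lemma gammaSID_K_P3 m : 2 < m ->
  is_gammaSID (direct_product (@complete_graph m) (@path_graph 3)) (2 * m + 3).
Proof.
move=> m2; have m1 := ltnW m2.
pose o0 : 'I_3 := inord 0; pose o1 : 'I_3 := inord 1; pose o2 : 'I_3 := inord 2.
have E0 : o0 = 0 :> nat by rewrite inordK.
have E1 : o1 = 1 :> nat by rewrite inordK.
have E2 : o2 = 2 :> nat by rewrite inordK.
have sumE (F : 'I_3 -> nat) : \sum_j F j = F o0 + F o1 + F o2.
  rewrite !big_ord_recr big_ord0 /= add0n.
  by congr (F _ + F _ + F _); apply: val_inj; rewrite /= ?E0 ?E1 ?E2.
have lf0 : leaf (@path_graph 3) o0 o1 by apply: path_leaf_first.
have lf2 : leaf (@path_graph 3) o2 o1 by apply: path_leaf_last; rewrite ?E1 E2.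
have e12 : path_graph o1 o2 by rewrite /path_graph E1 E2.
have e10 : path_graph o1 o0 by rewrite /path_graph E1 E0.
have n02 : o2 != o0 by rewrite -val_eqE /= E0 E2.
have n20 : o0 != o2 by rewrite eq_sym.
split=> [|S sidS].
  have F0 : layer (path_code m 3) o0 = setT by rewrite path_code_end ?E0.
  have F2 : layer (path_code m 3) o2 = setT by rewrite path_code_end ?E2.
  have F1 : #|layer (path_code m 3) o1| = 3 by rewrite card_path_code_inner ?E1.
  exists (path_code m 3); split.
    apply: separated_sid.
    - exact: direct_product_sym (@complete_graph_sym m) (@path_graph_sym 3).
    - by exists (Ordinal (ltnW m1), o2), (Ordinal (ltnW m1), o0);
        rewrite xpair_eqE negb_and n02 orbT.
    - apply: leaf_cover_separated => //; [exact: path_graph_sym|exact: path_graph_irr|].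
      move=> j; case: (eqVneq j o2) => [-> | j2].
        by exists o2, o1; rewrite F1 eqxx.
      exists o0, o1; rewrite F1; split=> //.
      by move: j2; rewrite -!val_eqE /= E0 E1 E2; case: j => [[|[|[|]]]].
  by rewrite card_layers sumE F0 F1 F2 cardsT card_ord mul2n -addnn addnAC.
(* Both ends share the neighbour [o1], and each serves as [r] for the other. *)
have S0 := leaf_layer_full (@path_graph_sym 3) lf0 e12 n02 sidS.
have S2 := leaf_layer_full (@path_graph_sym 3) lf2 e10 n20 sidS.
have S1 := support_layer_card (@path_graph_sym 3) (@path_graph_irr 3) m1 lf0 sidS.
rewrite card_layers sumE S0 S2 cardsT card_ord mul2n -addnn [leqRHS]addnAC.
by rewrite leq_add2l.
Qed.

Lemma gammaSID_K_P4 m : 2 < m ->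
  is_gammaSID (direct_product (@complete_graph m) (@path_graph 4)) (2 * m + 6).
Proof.
move=> m2; have m1 := ltnW m2.
pose o0 : 'I_4 := inord 0; pose o1 : 'I_4 := inord 1.
pose o2 : 'I_4 := inord 2; pose o3 : 'I_4 := inord 3.
have E0 : o0 = 0 :> nat by rewrite inordK.
have E1 : o1 = 1 :> nat by rewrite inordK.
have E2 : o2 = 2 :> nat by rewrite inordK.
have E3 : o3 = 3 :> nat by rewrite inordK.
(* The full end layers come first, so that [m + m] cancels in the lower bound. *)
have sumE (F : 'I_4 -> nat) : \sum_j F j = (F o0 + F o3) + (F o1 + F o2).
  rewrite !big_ord_recr big_ord0 /= add0n [RHS]addnAC [in RHS]addnA.
  by congr (F _ + F _ + F _ + F _); apply: val_inj; rewrite /= ?E0 ?E1 ?E2 ?E3.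
have lf0 : leaf (@path_graph 4) o0 o1 by apply: path_leaf_first.
have lf3 : leaf (@path_graph 4) o3 o2 by apply: path_leaf_last; rewrite ?E2 E3.
have e12 : path_graph o1 o2 by rewrite /path_graph E1 E2.
have e21 : path_graph o2 o1 by rewrite path_graph_sym.
have n02 : o2 != o0 by rewrite -val_eqE /= E0 E2.
have n13 : o1 != o3 by rewrite -val_eqE /= E1 E3.
split=> [|S sidS].
  have F0 : layer (path_code m 4) o0 = setT by rewrite path_code_end ?E0.
  have F3 : layer (path_code m 4) o3 = setT by rewrite path_code_end ?E3.
  have F1 : #|layer (path_code m 4) o1| = 3 by rewrite card_path_code_inner ?E1.
  have F2 : #|layer (path_code m 4) o2| = 3 by rewrite card_path_code_inner ?E2.
  exists (path_code m 4); split.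
    apply: separated_sid.
    - exact: direct_product_sym (@complete_graph_sym m) (@path_graph_sym 4).
    - by exists (Ordinal (ltnW m1), o2), (Ordinal (ltnW m1), o0);
        rewrite xpair_eqE negb_and n02 orbT.
    - apply: leaf_cover_separated => //; [exact: path_graph_sym|exact: path_graph_irr|].
      move=> j; case: (boolP ((j == o3) || (j == o2))) => [j32 | j32].
        by exists o3, o2; rewrite F2.
      exists o0, o1; rewrite F1; split=> //.
      by move: j32; rewrite -!val_eqE /= E0 E1 E2 E3; case: j => [[|[|[|[|]]]]].
  by rewrite card_layers sumE F0 F1 F2 F3 cardsT card_ord mul2n -addnn.
(* For each end, [r] is now the inner vertex at distance two; the two inner layers are supports of
   different ends and contribute three codewords each. *)
have S0 := leaf_layer_full (@path_graph_sym 4) lf0 e12 n02 sidS.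
have S3 := leaf_layer_full (@path_graph_sym 4) lf3 e21 n13 sidS.
have S1 := support_layer_card (@path_graph_sym 4) (@path_graph_irr 4) m1 lf0 sidS.
have S2 := support_layer_card (@path_graph_sym 4) (@path_graph_irr 4) m1 lf3 sidS.
rewrite card_layers sumE S0 S3 cardsT card_ord mul2n -addnn leq_add2l.
exact: (leq_add S1 S2).
Qed.

Theorem theoremA2 (m : nat) (hm : 4 <= m) :
  is_gammaSID (direct_product (@complete_graph m) (@path_graph 3)) (2 * m + 3) /\
  is_gammaSID (direct_product (@complete_graph m) (@path_graph 4)) (2 * m + 6).
Proof. by split; [apply: gammaSID_K_P3 | apply: gammaSID_K_P4]; apply: ltnW. Qed.
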